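(* Consider any deterministic adaptive $T$-call algorithm with $T<bm$, and any run of the batched delayed-rotation construction (described in the context) against it, producing queries $x_1,\dots,x_T$, responses $r_1,\dots,r_T$, terminal output $\widehat x$ and an orthonormal frame $U=(u_1,\dots,u_m)$. Define the single function $$F_U(x):=A\,h_{m,\rho}(U^\top x)+\frac\beta8\,\mathrm{dist}\bigl(x,B_2^d(R_0)\bigr)^2+\frac\eta2\|x\|_2^2,\qquad x\in\mathbb{R}^d.$$ Then $$r_t=F_U(x_t),\qquad t=1,\dots,T.$$ Consequently, the query sequence $x_1,\dots,x_T$ and the terminal output $\widehat x$ generated by the online construction are exactly the query sequence and output produced when the algorithm interacts with the fixed objective $F_U$.
   Context: Parameters. $d,m$ are positive integers with $m\le d/4$; $R,\beta>0$; $B_2^d(r)=\{x\in\mathbb{R}^d:\|x\|_2\le r\}$; $X=B_2^d(R)$; $R_0=R/4$; $\rho=R/(256m^{3/2})$; $A=\beta\rho/8$; $\eta=\beta/(4096m^2)$; $b=\lfloor d/4\rfloor$; $T=qb+s$ with integers $q\ge 0$ and $0\le s<b$ (so $T<bm$ gives $q\le m-1$). Functions. For $y\in\mathbb{R}^m$, $g_{m,\rho}(y)=\max_{1\le i\le m}\{y_i-8\rho i\}$ and $h_{m,\rho}(y)=\inf_{z\in\mathbb{R}^m}\{g_{m,\rho}(z)+\frac1\rho\|z-y\|_2^2\}$. For $x\in\mathbb{R}^d$, $q_0(x)=\frac\beta8\mathrm{dist}(x,B_2^d(R_0))^2+\frac\eta2\|x\|_2^2$ (Euclidean distance). Algorithms.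 A deterministic adaptive $T$-call algorithm consists of Borel maps $Q_t:(X\times\mathbb{R})^{t-1}\to X$, $t=1,\dots,T$, and $Q_{\mathrm{out}}:(X\times\mathbb{R})^T\to X$. Given responses $r_1,r_2,\dots$ it asks the queries $x_t=Q_t((x_1,r_1),\dots,(x_{t-1},r_{t-1}))$ and outputs $\widehat x=Q_{\mathrm{out}}((x_1,r_1),\dots,(x_T,r_T))$. Interacting with a fixed objective $f$ means $r_t=f(x_t)$ for all $t$. Batched delayed-rotation construction (a run of it against the algorithm). Queries are grouped into $q$ complete blocks of $b$ consecutive queries, the $j$-th being $x_{(j-1)b+1},\dots,x_{jb}$, followed by an incomplete block of $s$ queries. (1) For $j=1,\dots,q$: every query $x$ of block $j$ receives the response $r(x)=A\,h_{m,\rho}(\langle u_1,x\rangle,\dots,\langle u_{j-1},x\rangle,0,\dots,0)+q_0(x)$. After the block is finished, a unit vector $u_j$ is selected that is orthogonal to $u_1,\dots,u_{j-1}$ and to all queries of block $j$, and satisfies $|\langle u_j,x_t\rangle|\le\rho$ for every query $x_t$ of the earlier blocks $1,\dots,j-1$. (2) Each of the remaining $s$ queries $x$ receives the response $r(x)=A\,h_{m,\rho}(\langle u_1,x\rangle,\dots,\langle u_q,x\rangle,0,\dots,0)+q_0(x)$. The algorithm then produces its output $\widehat x$. (3) A unit vector $u_{q+1}$ is selected that is orthogonal to $u_1,\dots,u_q$, to $x_{qb+1},\dots,x_T$ and to $\widehat x$, and satisfies $|\langle u_{q+1},x_t\rangle|\le\rho$ for all $t\le qb$. (4) For $k=q+2,\dots,m$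 successively, a unit vector $u_k$ is selected that is orthogonal to $u_1,\dots,u_{k-1}$ and satisfies $|\langle u_k,x_t\rangle|\le\rho$ for $t=1,\dots,T$ and $|\langle u_k,\widehat x\rangle|\le\rho$. Finally $U=(u_1,\dots,u_m)\in\mathbb{R}^{d\times m}$. The response $r_t$ is $r(x_t)$. *)

(* Defs.v *)
From HB Require Import structures.
From mathcomp Require Import all_boot all_order all_algebra.
From mathcomp Require Import all_classical all_reals all_analysis.

Set Implicit Arguments.
Unset Strict Implicit.
Unset Printing Implicit Defensive.

Import Order.TTheory GRing.Theory Num.Theory.
Import numFieldNormedType.Exports.

Local Open Scope classical_set_scope.
Local Open Scope ring_scope.

(** Indices are 0-based throughout: [k : 'I_m] is the direction u_(k+1) and
    [t : 'I_T] is the call number t+1.  Points of R^d are column vectors. *)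

Section Euclidean.
Context {R : realType}.

Definition dotp d (u v : 'cV[R]_d) : R := \sum_(i < d) u i 0 * v i 0.

(* The library norm of a matrix is the sup norm, hence this one. *)
Definition norm2 d (x : 'cV[R]_d) : R := Num.sqrt (\sum_(i < d) x i 0 ^+ 2).

Definition ball2 d (r : R) : set 'cV[R]_d := [set x | norm2 x <= r].

Definition dist2 d (x : 'cV[R]_d) (S : set 'cV[R]_d) : R :=
  inf [set norm2 (x - y) | y in S].

End Euclidean.

Section Objective.
Context {R : realType}.
Variables (m : nat) (Rad beta : R).

Definition rho : R := Rad / (256 * m%:R `^ (3 / 2)).
Definition amplitude : R := beta * rho / 8.
Definition eta : R := beta / (4096 * m%:R ^+ 2).
Definition core_radius : R := Rad / 4.

(* The maximum is taken in \bar R because -oo is neutral there; for m > 0 it is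
   a finite real, so that [fine] loses nothing. *)
Definition gmax (rh : R) (y : 'cV[R]_m) : R :=
  fine (\big[maxe/-oo%E]_(i < m) (y i 0 - 8 * rh * i.+1%:R)%:E).

Definition henv (rh : R) (y : 'cV[R]_m) : R :=
  inf [set gmax rh z + rh^-1 * norm2 (z - y) ^+ 2 | z in [set: 'cV[R]_m]].

Definition q0 d (x : 'cV[R]_d) : R :=
  beta / 8 * dist2 x (ball2 core_radius) ^+ 2 + eta / 2 * norm2 x ^+ 2.

Definition objective d (U : 'M[R]_(d, m)) (x : 'cV[R]_d) : R :=
  amplitude * henv rho (U^T *m x)
  + beta / 8 * dist2 x (ball2 core_radius) ^+ 2 + eta / 2 * norm2 x ^+ 2.

(* Only the first [k] columns of [U] are used. *)
Definition partial_response d (U : 'M[R]_(d, m)) (k : nat) (x : 'cV[R]_d) : R :=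
  amplitude
    * henv rho (\col_(i < m) (if (i < k)%N then dotp (col i U) x else 0))
  + q0 x.

End Objective.

(* R^d with its Borel sigma-algebra.  Products and tuples below carry the
   library's product sigma-algebras, which are the Borel ones since all the
   factors are second countable. *)
Definition borelCV (R : realType) (d : nat) :=
  g_sigma_algebraType (@open 'cV[R]_d).

Section Algorithm.
Context {R : realType}.
Variables (d T : nat) (X : set 'cV[R]_d).

Definition call_record : Type := (borelCV R d * measurableTypeR R)%type.

Definition histories (n : nat) : set (n.-tuple call_record) :=
  [set w | forall i, X (tnth w i).1].

(* A Borel map (X * R)^n -> X is encoded as a map on the ambient space whose
   restriction to [histories n], a Borel set when [X] is one, is measurable
   and takes its values in [X]. *)
Structure algorithm : Type := Algorithm {
  query : forall t : 'I_T, t.-tuple call_record -> borelCV R d ;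
  output : T.-tuple call_record -> borelCV R d ;
  query_measurable : forall t : 'I_T, measurable_fun (@histories t) (@query t) ;
  query_mem : forall t : 'I_T, {homo @query t : w / @histories t w >-> X w} ;
  output_measurable : measurable_fun (@histories T) output ;
  output_mem : {homo output : w / @histories T w >-> X w} }.

Definition history (x : 'I_T -> 'cV[R]_d) (r : 'I_T -> R)
    (n : nat) (le_nT : (n <= T)%N) : n.-tuple call_record :=
  [tuple (x (widen_ord le_nT i), r (widen_ord le_nT i)) | i < n].

(* [x] and [xhat] are what [alg] asks and outputs when it receives [r]. *)
Definition plays (alg : algorithm) (x : 'I_T -> 'cV[R]_d) (r : 'I_T -> R)
    (xhat : 'cV[R]_d) : Prop :=
  (forall t : 'I_T, x t = query alg (history x r (ltnW (ltn_ord t))))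
  /\ xhat = output alg (history x r (leqnn T)).

Section FixedObjective.
Variables (alg : algorithm) (f : 'cV[R]_d -> R).

Fixpoint transcript (n : nat) : (n <= T)%N -> n.-tuple call_record :=
  if n is n'.+1 then fun lt_nT =>
    let w := transcript (ltnW lt_nT) in
    let x := query alg (t := Ordinal lt_nT) w in
    [tuple of rcons w (x, f x)]
  else fun=> [tuple].

Definition fixed_query (t : 'I_T) : 'cV[R]_d :=
  query alg (transcript (ltnW (ltn_ord t))).

Definition fixed_output : 'cV[R]_d := output alg (transcript (leqnn T)).

End FixedObjective.
End Algorithm.

Section Construction.
Context {R : realType}.
Variables (d m T : nat) (Rad beta : R).

(* With T = q * b + s and s < b, [q] is [nblocks]. *)
Definition block_size : nat := (d %/ 4)%N.
Definition nblocks : nat := (T %/ block_size)%N.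

Local Notation b := block_size.
Local Notation q := nblocks.

(* Block [j < q] (0-based) consists of the calls [t] with
   [j * b <= t < j.+1 * b], the incomplete block of those with [q * b <= t].
   For T < b * m one has q < m, so that all the directions exist. *)
Structure batched_run (alg : algorithm T (ball2 Rad : set 'cV[R]_d))
    (x : 'I_T -> 'cV[R]_d) (r : 'I_T -> R) (xhat : 'cV[R]_d)
    (U : 'M[R]_(d, m)) : Prop := BatchedRun {
  run_plays : plays alg x r xhat ;
  run_block_response : forall (j : nat) (t : 'I_T), (j < q)%N ->
    (j * b <= t < j.+1 * b)%N -> r t = partial_response Rad beta U j (x t) ;
  run_block_direction : forall j : 'I_m, (j < q)%N ->
    [/\ norm2 (col j U) = 1,
        forall i : 'I_m, (i < j)%N -> dotp (col j U) (col i U) = 0,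
        forall t : 'I_T, (j * b <= t < j.+1 * b)%N ->
          dotp (col j U) (x t) = 0
      & forall t : 'I_T, (t < j * b)%N ->
          `|dotp (col j U) (x t)| <= rho m Rad] ;
  run_last_response : forall t : 'I_T, (q * b <= t)%N ->
    r t = partial_response Rad beta U q (x t) ;
  run_last_direction : forall k : 'I_m, k = q :> nat ->
    [/\ norm2 (col k U) = 1,
        forall i : 'I_m, (i < k)%N -> dotp (col k U) (col i U) = 0,
        forall t : 'I_T, (q * b <= t)%N -> dotp (col k U) (x t) = 0,
        dotp (col k U) xhat = 0
      & forall t : 'I_T, (t < q * b)%N ->
          `|dotp (col k U) (x t)| <= rho m Rad] ;
  run_final_direction : forall k : 'I_m, (q < k)%N ->
    [/\ norm2 (col k U) = 1,
        forall i : 'I_m, (i < k)%N -> dotp (col k U) (col i U) = 0,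
        forall t : 'I_T, `|dotp (col k U) (x t)| <= rho m Rad
      & `|dotp (col k U) xhat| <= rho m Rad] }.

End Construction.

(* Main.v *)
Require Import Defs.
From mathcomp Require Import all_boot all_order all_algebra.
From mathcomp Require Import all_classical all_reals all_analysis.
From mathcomp Require Import lra.

Import Order.TTheory GRing.Theory Num.Theory.
Local Open Scope ring_scope.

(** With 0-based indices, a query [x] of block [j] satisfies [<u_j, x> = 0] and
    [<u_i, x> <= rho] for [i > j]. In the infimum defining [h (U^T x)],
    coordinate [j] of [z] may be assumed to be at least [-7 rho], as the
    quadratic penalty outweighs any gain below that value. The term of index
    [j] in [g z] is then at least [-7 rho - 8 rho (j + 1) = rho - 8 rho (j +
    2)], which dominates the terms of larger index at [z_i = <u_i, x>]. Hence
    these coordinates do not influence the value of [h] and can be replaced by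
    [0], which turns the final objective into the response given online. *)

Section Envelope.
Context {R : realType}.
Variables (m : nat) (rh : R).

(** The index [j] makes the range nonempty, so the maximum in [\bar R] is finite and [fine]
    preserves it. *)
Lemma gmax_leP (y : 'cV[R]_m) (c : R) (j : 'I_m) :
  gmax rh y <= c <-> forall i : 'I_m, y i 0 - 8 * rh * i.+1%:R <= c.
Proof.
pose f (i : 'I_m) := (y i 0 - 8 * rh * i.+1%:R)%:E.
have lef (i : 'I_m) : (f i <= \big[maxe/-oo]_(i < m) f i)%E by exact: le_bigmax.
have fin : (\big[maxe/-oo]_(i < m) f i)%E \is a fin_num.
  rewrite fin_numElt (lt_le_trans (ltNyr _) (lef j)) /=.
  by apply: bigmax_lt => // i _; rewrite ltry.
rewrite -lee_fin /gmax fineK//; split=> [le_c i|le_c].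
  by rewrite -lee_fin; apply: le_trans le_c; exact: lef.
by apply: bigmax_le => [|i _]; rewrite ?leNye ?lee_fin.
Qed.

Lemma gmax_ge (y : 'cV[R]_m) (i : 'I_m) : y i 0 - 8 * rh * i.+1%:R <= gmax rh y.
Proof. exact: (gmax_leP y _ i).1. Qed.

Lemma norm2_sqr (y : 'cV[R]_m) : norm2 y ^+ 2 = \sum_(i < m) y i 0 ^+ 2.
Proof. by rewrite sqr_sqrtr// sumr_ge0// => i _; rewrite sqr_ge0. Qed.

(** Each candidate [z] for [y] yields a candidate [z'] for [y'] of no larger value: it keeps [z]
    before [j], clips it from below at [j], and follows [y'] after [j], where the penalty then
    vanishes. *)
Lemma le_henv (y y' : 'cV[R]_m) (j : 'I_m) :
  0 < rh -> y j 0 = 0 -> (forall i : 'I_m, (i <= j)%N -> y' i 0 = y i 0) ->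
  (forall i : 'I_m, (j < i)%N -> y' i 0 <= rh) ->
  henv rh y' <= henv rh y.
Proof.
move=> rh0 yj0 eq_y y'_le; apply: lb_le_inf.
  by apply: image_nonempty; exists 0.
move=> _ [z _ <-].
have y'j0 : y' j 0 = 0 by rewrite eq_y.
pose c := Num.max (z j 0) (- 7 * rh).
pose z' := \col_i (if (i < j)%N then z i 0 else if i == j then c else y' i 0).
have z'j : z' j 0 = c by rewrite mxE ltnn eqxx.
apply: (@le_trans _ _ (gmax rh z' + rh^-1 * norm2 (z' - y') ^+ 2)).
  apply: ge_inf; last by exists z'.
  (* Only index [j] is kept in the maximum and in the penalty; [w + w^2 / rh] has minimum
     [- rh / 4]. *)
  exists (- (rh / 4) - 8 * rh * j.+1%:R) => _ [w _ <-].
  have : rh^-1 * w j 0 ^+ 2 <= rh^-1 * norm2 (w - y') ^+ 2.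
    rewrite ler_pM2l ?invr_gt0// norm2_sqr (bigD1 j)//= !mxE y'j0 subr0 lerDl.
    by rewrite sumr_ge0// => i _; rewrite sqr_ge0.
  have : - w j 0 - rh / 4 <= rh^-1 * w j 0 ^+ 2.
    rewrite ler_pdivlMl//.
    by have := sqr_ge0 (w j 0 + rh / 2); rewrite !expr2; lra.
  by have := gmax_ge w j; lra.
(* Clipping raises the maximum by at most [c - z j 0]; [quad] recovers this amount from the
   penalty. *)
have gz' : gmax rh z' <= gmax rh z + (c - z j 0).
  have zc : z j 0 <= c by rewrite le_max lexx.
  apply/(gmax_leP _ _ j) => i; rewrite mxE.
  case: ltngtP => [ij|ji|/val_inj ->].
  - by have := gmax_ge z i; lra.
  - rewrite -(inj_eq val_inj) gtn_eqF//.
    have := gmax_ge z j; have := y'_le _ ji.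
    have : rh * j.+2%:R <= rh * i.+1%:R by rewrite ler_pM2l// ler_nat.
    have : - 7 * rh <= c by rewrite le_max lexx orbT.
    by rewrite -[j.+2%:R]natr1; lra.
  - by rewrite eqxx; have := gmax_ge z j; lra.
have quad : rh^-1 * norm2 (z' - y') ^+ 2 + (c - z j 0)
    <= rh^-1 * norm2 (z - y) ^+ 2.
  have rest : \sum_(i < m | i != j) (z' - y') i 0 ^+ 2
      <= \sum_(i < m | i != j) (z - y) i 0 ^+ 2.
    apply: ler_sum => i; rewrite !mxE; case: ltngtP => [ij|ji|/val_inj ->].
    - by rewrite eq_y// ltnW.
    - by move/negPf ->; rewrite subrr expr0n sqr_ge0.
    - by rewrite eqxx.
  rewrite -(ler_pM2l rh0) mulrDr !mulVKf ?gt_eqF// !norm2_sqr.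
  rewrite (bigD1 j)//= [leRHS](bigD1 j)//=.
  have -> : (z' - y') j 0 = c by rewrite [LHS]mxE z'j mxE y'j0 subr0.
  have -> : (z - y) j 0 = z j 0 by rewrite !mxE yj0 subr0.
  suff : c ^+ 2 + rh * (c - z j 0) <= z j 0 ^+ 2 by lra.
  rewrite /c; case: (leP (- 7 * rh) (z j 0)) => zj; first by lra.
  (* With [c = -7 rh] the goal is [z^2 + rh z - 42 rh^2 >= 0], whose left side factors as this
     product; both factors are positive for [z < -7 rh]. *)
  have : 0 <= (- 7 * rh - z j 0) * (6 * rh - z j 0).
    by apply: mulr_ge0; lra.
  by rewrite !expr2; nra.
by lra.
Qed.

Lemma henv_eq (y y' : 'cV[R]_m) (j : 'I_m) :
  0 < rh -> y j 0 = 0 -> (forall i : 'I_m, (i <= j)%N -> y' i 0 = y i 0) ->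
  (forall i : 'I_m, (j < i)%N -> y i 0 <= rh) ->
  (forall i : 'I_m, (j < i)%N -> y' i 0 <= rh) ->
  henv rh y' = henv rh y.
Proof.
move=> rh0 yj0 eq_y y_le y'_le; apply/le_anti/andP.
split; apply: (@le_henv _ _ j) => //; first by rewrite eq_y.
by move=> i ij; rewrite eq_y.
Qed.

End Envelope.

Lemma rho_gt0 (R : realType) (m : nat) (Rad : R) :
  (0 < m)%N -> 0 < Rad -> 0 < rho m Rad.
Proof.
by move=> m0 Rad0; rewrite divr_gt0// mulr_gt0// powR_gt0// ltr0n.
Qed.

Lemma mul_trmx_dotp (R : realType) (d m : nat) (U : 'M[R]_(d, m))
    (x : 'cV[R]_d) (i : 'I_m) : (U^T *m x) i 0 = dotp (col i U) x.
Proof. by rewrite mxE; apply: eq_bigr => k _; rewrite !mxE. Qed.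

(** Truncation at [j] leaves coordinate [j] unchanged, as it vanishes already; the later coordinates
    are at most [rho] before and after, so [henv_eq] applies. *)
Lemma partial_response_objective {R : realType} {d m : nat} (Rad beta : R)
    (U : 'M[R]_(d, m)) (j : 'I_m) (x : 'cV[R]_d) :
  0 < rho m Rad -> dotp (col j U) x = 0 ->
  (forall i : 'I_m, (j < i)%N -> `|dotp (col i U) x| <= rho m Rad) ->
  partial_response Rad beta U j x = objective Rad beta U x.
Proof.
move=> rho0 uj0 u_le; rewrite /partial_response /objective /q0 addrA.
congr (_ * _ + _ + _); apply: (henv_eq _ _ _ _ j) => //.
- by rewrite mul_trmx_dotp.
- move=> i; rewrite mul_trmx_dotp mxE leq_eqVlt.
  by case: ltnP => // _ /orP[/eqP/val_inj ->|].
- by move=> i /u_le; rewrite mul_trmx_dotp; apply: le_trans; exact: ler_norm.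
- by move=> i ji; rewrite mxE ltnNge (ltnW ji)/= ltW.
Qed.

Section Transcript.
Context {R : realType} {d T : nat} {X : set 'cV[R]_d}.
Variables (alg : algorithm T X) (f : 'cV[R]_d -> R).
Variables (x : 'I_T -> 'cV[R]_d) (r : 'I_T -> R) (xhat : 'cV[R]_d).
Hypotheses (play : plays alg x r xhat) (rE : forall t, r t = f (x t)).

(** By determinism, equal records up to [n] force the same next query, and [rE] the same
    response. *)
Lemma history_transcript (n : nat) (le_nT : (n <= T)%N) :
  history x r le_nT = transcript alg f le_nT.
Proof.
elim: n le_nT => [|n IHn] lt_nT; first exact: tuple0.
have xn : x (Ordinal lt_nT) =
    query alg (t := Ordinal lt_nT) (transcript alg f (ltnW lt_nT)).
  rewrite play.1 /= -IHn; congr (query _ (history _ _ _)).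
  exact: bool_irrelevance.
apply: val_inj; rewrite /= -xn -rE -IHn /= /history /=.
rewrite enum_ordSr map_rcons -map_comp; congr rcons; last first.
  by congr (x _, r _); exact: val_inj.
by apply: eq_map => i /=; congr (x _, r _); exact: val_inj.
Qed.

Lemma plays_fixed_query (t : 'I_T) : x t = fixed_query alg f t.
Proof. by rewrite play.1 history_transcript. Qed.

Lemma plays_fixed_output : xhat = fixed_output alg f.
Proof. by rewrite play.2 history_transcript. Qed.

End Transcript.

Lemma batched_run_response {R : realType} {d m T : nat} {Rad beta : R}
    {alg : algorithm T (ball2 Rad : set 'cV[R]_d)}
    {x : 'I_T -> 'cV[R]_d} {r : 'I_T -> R} {xhat : 'cV[R]_d}
    {U : 'M[R]_(d, m)} (run : batched_run beta alg x r xhat U) (t : 'I_T) :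
  0 < Rad -> (T < d %/ 4 * m)%N -> r t = objective Rad beta U (x t).
Proof.
move=> Rad0 ltT.
pose b := block_size d; pose q := nblocks d T.
(* An empty block size would turn the bound on [T] into [T < 0]. *)
have b0 : (0 < b)%N.
  by rewrite lt0n; apply: contraTneq ltT => e; rewrite -/(block_size d) -/b e.
have qm : (q < m)%N by rewrite /q /nblocks ltn_divLR// mulnC.
have rho0 : 0 < rho m Rad by rewrite rho_gt0// (leq_ltn_trans _ qm).
case: (ltnP t (q * b)) => tq.
- pose j := (t %/ b)%N.
  have jq : (j < q)%N by rewrite ltn_divLR.
  have tj : (j * b <= t < j.+1 * b)%N by rewrite leq_divM ltn_ceil.
  rewrite (run_block_response run jq tj).
  have jm := ltn_trans jq qm.
  apply: (partial_response_objective _ _ _ (Ordinal jm)) => //.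
    by have [_ _ + _] := run_block_direction run (j := Ordinal jm) jq; apply.
  (* The bound on a later direction comes from the stage that selected it; for [i < q], the call
     precedes block [i] because [t < (j + 1) b <= i b]. *)
  move=> i /= ji; case: (ltngtP i q) => iq.
  + have [_ _ _] := run_block_direction run iq; apply.
    case/andP: tj => _ /leq_trans; apply; by rewrite leq_mul2r ji orbT.
  + by have [_ _ + _] := run_final_direction run iq; apply.
  + by have [_ _ _ _] := run_last_direction run iq; apply.
- rewrite (run_last_response run tq).
  apply: (partial_response_objective _ _ _ (Ordinal qm)) => //.
    have [_ _ + _ _] := run_last_direction run (k := Ordinal qm) erefl.
    by apply.
  by move=> i qi; have [_ _ + _] := run_final_direction run qi; apply.
Qed.

Theorem proposition9p1 (R : realType) (d m T : nat) (Rad beta : R)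
    (m_gt0 : (0 < m)%N) (le_4m_d : (4 * m <= d)%N)
    (Rad_gt0 : 0 < Rad) (beta_gt0 : 0 < beta)
    (lt_T : (T < d %/ 4 * m)%N)
    (alg : algorithm T (ball2 Rad : set 'cV[R]_d))
    (x : 'I_T -> 'cV[R]_d) (r : 'I_T -> R) (xhat : 'cV[R]_d)
    (U : 'M[R]_(d, m))
    (run : batched_run beta alg x r xhat U) :
  (forall t : 'I_T, r t = objective Rad beta U (x t))
  /\ (forall t : 'I_T, x t = fixed_query alg (objective Rad beta U) t)
  /\ xhat = fixed_output alg (objective Rad beta U).
Proof.
have rE (t : 'I_T) : r t = objective Rad beta U (x t).
  exact: batched_run_response run t Rad_gt0 lt_T.
have play := run_plays run.
split=> //; split=> [t|]; first exact: plays_fixed_query play rE t.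
exact: plays_fixed_output play rE.
Qed.
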